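(* Let $\mathcal{X}_j = [m_j]$ with $m_j \in \mathbb{N}$ for $j \in [d]$. Fix $\alpha,\beta \in (0,1)$. Whenever $P_{\mathbb{S}} = (P_S : S \in \mathbb{S}) \in \mathcal{P}_{\mathbb{S}}^0$, we have $\mathbb{P}_{P_{\mathbb{S}}}\bigl(R(\widehat{P}_{\mathbb{S}}) \geq C_\alpha\bigr) \leq \alpha$. Moreover, for any $P_{\mathbb{S}} \in \mathcal{P}_{\mathbb{S}}$ satisfying \[ R(P_{\mathbb{S}}) \geq C_\alpha + C_\beta, \] we have $\mathbb{P}_{P_{\mathbb{S}}}\bigl(R(\widehat{P}_{\mathbb{S}}) \geq C_\alpha\bigr) \geq 1-\beta$.
   Context: Let $d \in \mathbb{N}$, $[m] := \{1,\ldots,m\}$, $\mathcal{X}_S := \prod_{j \in S}\mathcal{X}_j$ for $S \subseteq [d]$, $\mathcal{X} := \mathcal{X}_{[d]}$, $x_S := (x_j : j\in S)$, and let $\mathbb{S}$ be a non-empty collection of subsets of $[d]$. $\mathcal{P}_{\mathbb{S}}$ is the set of sequences $P_{\mathbb{S}} = (P_S : S \in \mathbb{S})$ with $P_S$ a probability distribution on $\mathcal{X}_S$, and $\mathcal{P}_{\mathbb{S}}^0 \subseteq \mathcal{P}_{\mathbb{S}}$ is the subset of compatible sequences: those for which there is a distribution on $\mathcal{X}$ with marginal $P_S$ on $\mathcal{X}_S$ for every $S \in \mathbb{S}$. Data: for given $n_S \in \mathbb{N}$, $S \in \mathbb{S}$, we observe independent random variables $(X_{S,i})_{S \in \mathbb{S},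 i \in [n_S]}$ with $X_{S,i} \sim P_S$; $\mathbb{P}_{P_{\mathbb{S}}}$ denotes probability under this model. $\widehat{P}_S$ is the empirical distribution of $X_{S,1},\ldots,X_{S,n_S}$ and $\widehat{P}_{\mathbb{S}} := (\widehat{P}_S : S \in \mathbb{S})$. Incompatibility index (discrete case): let $\mathcal{G}_{\mathbb{S}}^+$ be the set of sequences $f_{\mathbb{S}} = (f_S : S \in \mathbb{S})$ of functions $f_S : \mathcal{X}_S \to [-1,\infty)$ with $\min_{x \in \mathcal{X}} \sum_{S \in \mathbb{S}} f_S(x_S) \geq 0$. Then $R(P_{\mathbb{S}}) := \sup_{f_{\mathbb{S}} \in \mathcal{G}_{\mathbb{S}}^+} R(P_{\mathbb{S}},f_{\mathbb{S}})$ with $R(P_{\mathbb{S}},f_{\mathbb{S}}) := -\frac{1}{|\mathbb{S}|}\sum_{S \in \mathbb{S}} \sum_{x_S \in \mathcal{X}_S} f_S(x_S) P_S(\{x_S\})$. Critical value: for $\alpha \in (0,1)$, \[ C_\alpha := \frac{1}{2} \sum_{S \in \mathbb{S}} \Bigl( \frac{|\mathcal{X}_S|-1}{n_S} \Bigr)^{1/2} + \Bigl\{ \frac{1}{2} \log(1/\alpha) \sum_{S \in \mathbb{S}} \frac{1}{n_S} \Bigr\}^{1/2}. \] *)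

(* Defs.v *)
From HB Require Import structures.
From mathcomp Require Import all_boot all_order all_algebra.
From mathcomp Require Import all_classical all_reals all_analysis.
Set Implicit Arguments.
Unset Strict Implicit.
Unset Printing Implicit Defensive.
Import Order.TTheory GRing.Theory Num.Theory.
Import numFieldNormedType.Exports.
Local Open Scope classical_set_scope.
Local Open Scope ring_scope.

(** The alphabets [m_j] = {1, ..., m_j} are 'I_(m j), and the indices [d] are
    'I_d.  [space_on m S] is the product of the alphabets over j in S; it is a
    singleton when S is empty. *)
Definition space (d : nat) (m : 'I_d -> nat) : finType :=
  {dffun forall j : 'I_d, 'I_(m j)}.

Definition space_on (d : nat) (m : 'I_d -> nat) (S : {set 'I_d}) : finType :=
  {dffun forall j : {j : 'I_d | j \in S}, 'I_(m (val j))}.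

Definition restr (d : nat) (m : 'I_d -> nat) (S : {set 'I_d}) (x : space m) :
    space_on m S :=
  [ffun j : {j : 'I_d | j \in S} => x (val j)].

(** Sequences indexed by the collection SS are functions on its subtype. *)
Definition members (d : nat) (SS : {set {set 'I_d}}) : finType :=
  {S : {set 'I_d} | S \in SS}.

(** A probability distribution on a finite set is given by its mass function. *)
Definition is_distr (R : realType) (T : finType) (p : T -> R) : Prop :=
  (forall x, 0 <= p x) /\ \sum_x p x = 1.

Section Sequences.
Variables (R : realType) (d : nat) (m : 'I_d -> nat) (SS : {set {set 'I_d}}).

Definition fun_seq := forall S : members SS, space_on m (val S) -> R.

Definition distr_seq (P : fun_seq) : Prop := forall S, is_distr (P S).

Definition compatible (P : fun_seq) : Prop :=
  exists Q : space m -> R, is_distr Q /\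
    forall (S : members SS) (y : space_on m (val S)),
      \sum_(x : space m | restr (val S) x == y) Q x = P S y.

Definition Gplus : set fun_seq :=
  [set f | (forall S y, -1 <= f S y) /\
           (forall x : space m, 0 <= \sum_(S : members SS) f S (restr (val S) x))].

Definition pairing (P f : fun_seq) : R :=
  - (#|SS|%:R^-1 *
     \sum_(S : members SS) \sum_(y : space_on m (val S)) f S y * P S y).

(** When P is a sequence of distributions the set below contains 0 and is
    bounded above by 1, so that [sup] is a genuine supremum. *)
Definition incompat_index (P : fun_seq) : R :=
  sup [set pairing P f | f in Gplus].

Definition critical_value (n : members SS -> nat) (alpha : R) : R :=
  2^-1 * (\sum_(S : members SS)
            Num.sqrt ((#|space_on m (val S)|%:R - 1) / (n S)%:R))
  + Num.sqrt (2^-1 * ln (1 / alpha) * \sum_(S : members SS) 1 / (n S)%:R).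

Definition empirical (n : members SS -> nat)
    (x : forall S : members SS, 'I_(n S) -> space_on m (val S)) : fun_seq :=
  fun S y => (\sum_(i < n S) (x S i == y)%:R) / (n S)%:R.

End Sequences.

Section RandomElements.
Variables (R : realType) (dO : measure_display) (Omega : measurableType dO).

(** The finite set T carries its discrete sigma-algebra. *)
Definition random_element (T : finType) (X : Omega -> T) : Prop :=
  forall A : set T, measurable (X @^-1` A).

Definition has_law (Pr : probability Omega R) (T : finType) (X : Omega -> T)
    (p : T -> R) : Prop :=
  forall y : T, Pr (X @^-1` [set y]) = (p y)%:E.

Definition mutually_independent (Pr : probability Omega R) (I : finType)
    (T : I -> finType) (X : forall k : I, Omega -> T k) : Prop :=
  forall (J : {set I}) (A : forall k : I, set (T k)),
    Pr (\bigcap_(k in [set k | k \in J]) (X k @^-1` A k)) =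
    (\prod_(k in J) Pr (X k @^-1` A k))%E.

End RandomElements.

(* Main.v *)
Require Import Defs.
From HB Require Import structures.
From mathcomp Require Import all_boot all_order all_algebra.
From mathcomp Require Import all_classical all_reals all_analysis.
From mathcomp Require Import ring lra.
Import Order.TTheory GRing.Theory Num.Theory.
Import numFieldNormedType.Exports.
Local Open Scope classical_set_scope.
Local Open Scope ring_scope.
Set Implicit Arguments.
Unset Strict Implicit.
Unset Printing Implicit Defensive.

(** Both claims reduce to one tail bound for the deviation D between the
    empirical distributions and P, where D is the sum over S of the total
    variation distances between the S-components.

    The index is 1-Lipschitz for this sum ([incompat_index_lip]).  In the
    supremum that defines it, f may be replaced by its truncation at |SS| - 1:
    if some f_S reaches that level, the other |SS| - 1 terms, each at least -1,
    cannot make the sum negative.  The truncated functions take values in an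
    interval of length |SS|, which the normalization 1/|SS| turns into total
    variation distances.  Moreover the index of a compatible P is at most 0
    ([incompat_index_compatible]).  Hence for compatible P, rejection at level
    C_alpha forces D >= C_alpha; and if the index of P is at least
    C_alpha + C_beta, acceptance forces D > C_beta.

    It remains to see that D >= C_alpha has probability at most alpha
    ([deviation_tail]).  The two terms of C_alpha have different origins.  The
    first bounds the mean of D ([expect_deviation]): by Jensen and
    Cauchy-Schwarz, the mean L1 error of an empirical distribution on N points
    is at most the square root of N times the sum of the variances
    p (1 - p) / n, and the sum of p (1 - p) is at most 1 - 1/N.  The second is
    the deviation allowed by McDiarmid's inequality ([mcdiarmid]): changing one
    of the n_S observations in the S-sample changes D by at most 1/n_S, and the
    squares of these constants sum to the sum of the 1/n_S.

    The test depends on the outcome only through the finitely many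
    observations, whose joint law is a product mass function
    ([probability_joint]); the probabilistic estimates are therefore made with
    finite sums on a finite product. *)

(** * Hoeffding's lemma and a weighted Cauchy-Schwarz inequality *)

Lemma ge0_is_derive_le (R : realType) (f df : R -> R) (a b : R) :
  a <= b -> (forall x, a <= x -> is_derive x 1 f (df x)) ->
  (forall x, a <= x -> 0 <= df x) -> f a <= f b.
Proof.
move=> ab fE df_ge0.
have [||c /[!in_itv]/= /andP[ac _] fab] := @MVT_segment R f df a b ab.
- by move=> x /[!in_itv]/= /andP[ax _]; exact/fE/ltW.
- apply: derivable_within_continuous => x /[!in_itv]/= /andP[ax _].
  by have := fE x ax; case.
by rewrite -subr_ge0 fab mulr_ge0 ?df_ge0// subr_ge0.
Qed.

(** This is the case of two values in Hoeffding's lemma.  The quotient of the two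
    sides is nonincreasing in u, because the mean of the tilted Bernoulli law,
    p e^u / (1 - p + p e^u), stays below p + u / 4: its derivative in u is the
    variance of a Bernoulli law, at most 1/4. *)
Lemma bernoulli_mgf_le (R : realType) (p u : R) : 0 <= p <= 1 -> 0 <= u ->
  1 - p + p * expR u <= expR (p * u + u ^+ 2 / 8).
Proof.
move=> /andP[p0 p1] u0.
have q_gt0 (x : R) : 0 <= x -> 0 < 1 - p + p * expR x.
  move=> x0; have ex : 1 <= expR x by rewrite -expR0 ler_expR.
  by nra.
have tilt (x : R) : 0 <= x -> p * expR x / (1 - p + p * expR x) <= p + x / 4.
  move=> x0.
  pose k (y : R) := y / 4 + (1 - p) * (1 - p + p * expR y)^-1.
  pose dk (y : R) := 4^-1 - (1 - p) * p * expR y / (1 - p + p * expR y) ^+ 2.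
  have kE (y : R) : 0 <= y -> is_derive y 1 k (dk y).
    move=> y0; have qy := q_gt0 y y0.
    have inv_d : is_derive y 1 (fun z => (1 - p + p * expR z)^-1)
        (- (1 - p + p * expR y) ^- 2 *: (p * expR y)).
      apply: is_deriveV; first exact: lt0r_neq0.
      by apply: is_derive_eq; rewrite /GRing.scale/=; ring.
    rewrite /k; apply: is_derive_eq.
    rewrite /dk /GRing.scale/=; field; exact: lt0r_neq0.
  have dk0 (y : R) : 0 <= y -> 0 <= dk y.
    move=> y0; have qy := q_gt0 y y0; rewrite /dk.
    rewrite subr_ge0 ler_pdivrMr ?exprn_gt0//.
    rewrite ler_pdivlMl//.
    by have := sqr_ge0 (1 - p - p * expR y); nra.
  have := ge0_is_derive_le x0 kE dk0.
  rewrite /k expR0 mul0r add0r mulr1 subrK invr1 mulr1 => h.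
  have qx := q_gt0 x x0.
  suff -> : p * expR x / (1 - p + p * expR x) = 1 - (1 - p) / (1 - p + p * expR x).
    by lra.
  by field; exact: lt0r_neq0.
pose g (y : R) := - ((1 - p + p * expR y) * expR (- (p * y + y ^+ 2 / 8))).
pose dg (y : R) := expR (- (p * y + y ^+ 2 / 8)) *
   ((1 - p + p * expR y) * (p + y / 4) - p * expR y).
have gE (y : R) : 0 <= y -> is_derive y 1 g (dg y).
  move=> y0; rewrite /g.
  have ed : is_derive y 1 (fun z : R => expR (- (p * z + z ^+ 2 / 8)))
      (expR (- (p * y + y ^+ 2 / 8)) * - (p + y / 4)).
    apply: is_derive1_comp.
    apply: is_derive_eq.
    rewrite /GRing.scale/=. by field.
  apply: is_derive_eq.
  rewrite /dg /GRing.scale/=. by ring.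
have dg0 (y : R) : 0 <= y -> 0 <= dg y.
  move=> y0; rewrite mulr_ge0 ?expR_ge0// subr_ge0 [leRHS]mulrC -ler_pdivrMr ?q_gt0//.
  exact: tilt.
have := ge0_is_derive_le u0 gE dg0.
rewrite /g expR0 mulr1 subrK mulr0 expr0n/= mul0r addr0 oppr0 expR0 mulr1.
by rewrite lerN2 expRN ler_pdivrMr ?expR_gt0// mul1r.
Qed.

(** Both endpoint values lie above the tangent to the exponential at t u, and
    averaging these two tangent bounds gives the claim. *)
Lemma expR_chord (R : realType) (t u : R) : 0 <= t <= 1 ->
  expR (t * u) <= 1 - t + t * expR u.
Proof.
move=> /andP[t0 t1].
have tangent (x : R) : expR (t * u) * (1 + (x - t * u)) <= expR x.
  rewrite -{2}(subrK (t * u) x) expRD mulrC.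
  by rewrite ler_wpM2r ?expR_ge0// expR_ge1Dx.
have h0 := ler_wpM2l (_ : 0 <= 1 - t) (tangent 0).
have h1 := ler_wpM2l t0 (tangent u).
move: h0; rewrite subr_ge0 expR0 mulr1 => /(_ t1) h0.
apply: le_trans (lerD h0 h1).
by rewrite le_eqVlt; apply/orP; left; apply/eqP; ring.
Qed.

(** Hoeffding's lemma.  On an interval of length c the exponential lies below its
    chord, so the worst law with a given mean is carried by the two endpoints;
    [bernoulli_mgf_le] bounds that one. *)
Lemma hoeffding_mgf (R : realType) (T : finType) (p g : T -> R) (c l : R) :
  is_distr p -> (forall a b, g a - g b <= c) -> 0 <= l ->
  \sum_a p a * expR (l * g a) <=
  expR (l ^+ 2 * c ^+ 2 / 8) * expR (l * \sum_a p a * g a).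
Proof.
move=> [p_ge0 p1] gc l0.
have [a0 _|T0] := pickP (@predT T); last first.
  move: p1; rewrite big_pred0; last by move=> a; have := T0 a.
  by move/eqP; rewrite eq_sym oner_eq0.
pose L := g [arg min_(a < a0) g a]%O.
have gL a : L <= g a by rewrite /L; case: arg_minP => // b _; apply.
have c0 : 0 <= c by have := gc a0 a0; rewrite subrr.
pose t a := (g a - L) / c.
have tE a : t a * c = g a - L.
  have [c_eq0|cN0] := eqVneq c 0; last by rewrite /t divfK.
  by have := gc a [arg min_(a < a0) g a]%O; rewrite -/L /t c_eq0; have := gL a; lra.
have t01 a : 0 <= t a <= 1.
  have gcL : g a - L <= c by exact: gc.
  have [c_eq0|cN0] := eqVneq c 0; first by rewrite /t c_eq0 invr0 mulr0 lexx ler01.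
  have cp : 0 < c by rewrite lt_neqAle eq_sym cN0.
  by rewrite /t divr_ge0 ?subr_ge0 ?gL//= ler_pdivrMr ?mul1r.
pose q := \sum_a p a * t a.
have q01 : 0 <= q <= 1.
  rewrite /q sumr_ge0 => [|a _]; last by rewrite mulr_ge0//; case/andP: (t01 a).
  rewrite -p1 ler_sum// => a _; rewrite -[leRHS]mulr1 ler_wpM2l//.
  by case/andP: (t01 a).
have meanE : \sum_a p a * g a = L + q * c.
  rewrite /q mulr_suml -[L]mul1r -p1 mulr_suml -big_split/=.
  by apply: eq_bigr => a _; rewrite -mulrA tE; ring.
rewrite meanE.
apply: (@le_trans _ _ (\sum_a p a * (expR (l * L) * (1 - t a + t a * expR (l * c))))).
  apply: ler_sum => a _; rewrite ler_wpM2l//.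
  rewrite -[g a](subrK L) -tE addrC mulrDr expRD ler_wpM2l ?expR_ge0//.
  by rewrite mulrCA expR_chord.
rewrite (_ : \sum_a _ = expR (l * L) * (1 - q + q * expR (l * c))); last first.
  rewrite /q -[in RHS]p1 mulr_suml -sumrB -big_split/= mulr_sumr.
  by apply: eq_bigr => a _; ring.
rewrite [l * (L + _)]mulrDr [expR (l * L + _)]expRD mulrCA ler_wpM2l ?expR_ge0// -expRD.
have := bernoulli_mgf_le q01 (mulr_ge0 l0 c0).
by congr (_ <= expR _); ring.
Qed.

Lemma weighted_cauchy (R : realType) (T : finType) (w a : T -> R) :
  (forall i, 0 <= w i) ->
  (\sum_i w i * a i) ^+ 2 <= (\sum_i w i) * \sum_i w i * a i ^+ 2.
Proof.
move=> w0; set W := \sum_i w i; set M := \sum_i w i * a i.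
set Q := \sum_i w i * a i ^+ 2.
have W0 : 0 <= W by exact: sumr_ge0.
have [W_eq0|WN0] := eqVneq W 0.
  have wi0 i : w i = 0.
    exact: (psumr_eq0P (fun j _ => w0 j) W_eq0).
  by rewrite W_eq0 mul0r /M big1 ?expr0n// => i _; rewrite wi0 mul0r.
have Wp : 0 < W by rewrite lt_neqAle eq_sym WN0.
(* Up to a positive factor, this is the weighted variance of a. *)
have : 0 <= \sum_i w i * (a i * W - M) ^+ 2.
  by apply: sumr_ge0 => i _; rewrite mulr_ge0 ?sqr_ge0.
rewrite (_ : \sum_i _ = W * (W * Q - M ^+ 2)); last first.
  rewrite (eq_bigr (fun i => W ^+ 2 * (w i * a i ^+ 2)
      + (- 2 * W * M * (w i * a i) + M ^+ 2 * w i))); last by move=> i _; ring.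
  by rewrite !big_split/= -!mulr_sumr -/W -/M -/Q; ring.
by rewrite pmulr_rge0// subr_ge0.
Qed.

(** * McDiarmid's inequality on a finite product *)

Section ProductMeasure.
Variables (R : realType) (K : finType) (T : K -> finType).
Variable p : forall k, T k -> R.
Hypothesis p_distr : forall k, is_distr (@p k).

Local Notation point := {dffun forall k, T k}.

Implicit Types (z : point) (F G : point -> R) (s : seq K).

Definition product_mass (z : point) : R := \prod_k p (z k).

Definition expect (F : point -> R) : R := \sum_z product_mass z * F z.

Definition resample (z : point) k (a : T k) : point :=
  [ffun j => eqtype.dfwith (fun i => z i) a j].

(** The conditional expectation of F given all coordinates except k. *)
Definition average (k : K) (F : point -> R) (z : point) : R :=
  \sum_(a : T k) p a * F (resample z a).

Definition averages (s : seq K) (F : point -> R) : point -> R :=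
  foldr average F s.

Lemma resample_in z k (a : T k) : resample z a k = a.
Proof. by rewrite ffunE eqtype.dfwith_in. Qed.

Lemma resample_out z k (a : T k) j : k != j -> resample z a j = z j.
Proof. by move=> kj; rewrite ffunE eqtype.dfwith_out. Qed.

Lemma resample_id z k : resample z (z k) = z.
Proof. by apply/ffunP => j; rewrite ffunE; case: eqtype.dfwithP. Qed.

Lemma resample_twice z k (a b : T k) : resample (resample z a) b = resample z b.
Proof.
apply/ffunP => j; have [<-|kj] := eqVneq k j; first by rewrite !resample_in.
by rewrite !resample_out.
Qed.

Lemma resample_comm z k (a : T k) l (b : T l) : k != l ->
  resample (resample z a) b = resample (resample z b) a.
Proof.
move=> kl; apply/ffunP => j; have [<-|lj] := eqVneq l j.
  by rewrite resample_in resample_out// resample_in.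
rewrite resample_out//; have [<-|kj] := eqVneq k j; first by rewrite !resample_in.
by rewrite !resample_out.
Qed.

Lemma product_mass_ge0 z : 0 <= product_mass z.
Proof. by apply: prodr_ge0 => k _; case: (p_distr k). Qed.

Lemma product_mass_resample z k (a : T k) :
  product_mass z * p a = product_mass (resample z a) * p (z k).
Proof.
rewrite /product_mass (bigD1 k)//= [in RHS](bigD1 k)//= resample_in.
rewrite [X in _ = p a * X * _](eq_bigr (fun j => p (z j))); first by ring.
by move=> j jk; rewrite resample_out// eq_sym.
Qed.

Lemma product_mass_sum1 : \sum_z product_mass z = 1.
Proof.
rewrite (reindex (@dffun_of_fprod K T)); last first.
  exact/onW_bij/dffun_of_fprod_bij.
transitivity (\sum_(z : fprod T) \prod_(k in K) [ffun a => @p k a] (z k)).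
  by apply: eq_bigr => z _; apply: eq_bigr => k _; rewrite !ffunE.
rewrite (@big_fprod _ _ _ _ _ K T (fun k => [ffun a => @p k a])).
rewrite -(bigA_distr_big_dep (fun i => tagged_with T i)
  (fun i => untag 0 [ffun a => @p i a])).
rewrite big1// => k _.
transitivity (\sum_a [ffun b => @p k b] a).
  exact/esym/(big_tag (fun i => [ffun b => @p i b])).
by case: (p_distr k) => _ <-; apply: eq_bigr => a _; rewrite ffunE.
Qed.

(** Exchanging the coordinate z k with an independent copy of it preserves the
    joint law of the point and the copy. *)
Lemma expect_average k F : expect (average k F) = expect F.
Proof.
rewrite /expect /average.
under eq_bigr do rewrite mulr_sumr.
rewrite pair_bigA/=.
pose swap (u : point * T k) := (resample u.1 u.2, u.1 k).
have swapK : involutive swap.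
  by case=> z a; rewrite /swap/= resample_twice resample_id resample_in.
rewrite (reindex_inj (inv_inj swapK))/=.
under eq_bigr => u _.
  rewrite mulrA resample_twice resample_id -product_mass_resample -mulrA mulrCA.
  over.
transitivity (\sum_z \sum_(a : T k) p a * (product_mass z * F z)).
  by rewrite pair_bigA/=; apply: eq_bigr => u _; ring.
by apply: eq_bigr => z _; rewrite -mulr_suml; case: (p_distr k) => _ ->; rewrite mul1r.
Qed.

Lemma expect_cst c : expect (fun=> c) = c.
Proof. by rewrite /expect -mulr_suml product_mass_sum1 mul1r. Qed.

Lemma le_expect F G : (forall z, F z <= G z) -> expect F <= expect G.
Proof. by move=> FG; apply: ler_sum => z _; rewrite ler_wpM2l ?product_mass_ge0. Qed.

Lemma expectD F G : expect (fun z => F z + G z) = expect F + expect G.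
Proof. by rewrite /expect -big_split/=; apply: eq_bigr => z _; rewrite mulrDr. Qed.

Lemma expectZ c F : expect (fun z => c * F z) = c * expect F.
Proof. by rewrite /expect mulr_sumr; apply: eq_bigr => z _; ring. Qed.

Lemma expect_sum (I : finType) (F : I -> point -> R) :
  expect (fun z => \sum_i F i z) = \sum_i expect (F i).
Proof.
rewrite /expect exchange_big/=.
by apply: eq_bigr => z _; rewrite mulr_sumr.
Qed.

Lemma averages_local s F (z z' : point) :
  (forall k, k \notin s -> z k = z' k) -> averages s F z = averages s F z'.
Proof.
elim: s z z' => [|k s IHs] z z' zz'; first by congr F; apply/ffunP => k; exact: zz'.
apply: eq_bigr => a _; congr (_ * _); apply: IHs => j js.
have [<-|kj] := eqVneq k j; first by rewrite !resample_in.
by rewrite !resample_out// zz'// inE eq_sym negb_or kj.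
Qed.

(** Averaging over every coordinate gives a function that is constant
    ([averages_local]) and has the same expectation as F. *)
Lemma averages_enum F z : averages (enum K) F z = expect F.
Proof.
have -> : expect F = expect (averages (enum K) F).
  by elim: (enum K) => //= k s IHs; rewrite expect_average.
rewrite -[LHS]expect_cst; congr expect; apply/funext => z'.
by apply: averages_local => k; rewrite mem_enum.
Qed.

Lemma le_average k F G z : (forall z, F z <= G z) -> average k F z <= average k G z.
Proof.
by move=> FG; apply: ler_sum => a _; rewrite ler_wpM2l//; case: (p_distr k).
Qed.

Lemma expect_coord k (g : T k -> R) :
  expect (fun z => g (z k)) = \sum_a p a * g a.
Proof.
rewrite -(expect_average k) -[RHS]expect_cst; congr expect; apply/funext => z.
by apply: eq_bigr => a _; rewrite resample_in.
Qed.

Lemma expect_coord2 k l (g : T k -> R) (h : T l -> R) : k != l ->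
  \sum_a p a * g a = 0 -> expect (fun z => g (z k) * h (z l)) = 0.
Proof.
move=> kl g0; rewrite -(expect_average k) -[RHS]expect_cst; congr expect.
apply/funext => z; rewrite -[RHS](mul0r (h (z l))) -g0 mulr_suml.
by apply: eq_bigr => a _; rewrite resample_in resample_out// mulrA.
Qed.

Section BoundedDifferences.
Variables (F : point -> R) (c : K -> R).
Hypothesis F_diff : forall z k (a : T k), F (resample z a) - F z <= c k.

(** Averaging keeps the bounds on the differences; a resampled coordinate is
    forgotten when it is the one that is averaged out. *)
Lemma averages_diff s z k (a : T k) :
  averages s F (resample z a) - averages s F z <= c k.
Proof.
elim: s z => [|l s IHs] z; first exact: F_diff.
rewrite /= /average -sumrB.
have [p_ge0 p_sum1] := p_distr l.
rewrite -[leRHS]mul1r -p_sum1 mulr_suml.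
apply: ler_sum => b _; rewrite -mulrBr ler_wpM2l//.
have [lk|lk] := eqVneq l k; last by rewrite resample_comm 1?eq_sym.
by subst l; rewrite resample_twice subrr; have := F_diff z (z k);
   rewrite resample_id subrr.
Qed.

(** Averaging out one coordinate at a time costs one application of Hoeffding's
    lemma to a function whose oscillation in that coordinate is controlled by
    [averages_diff]. *)
Lemma averages_mgf (l : R) s z : 0 <= l ->
  averages s (fun z => expR (l * F z)) z <=
  expR (l ^+ 2 / 8 * \sum_(k <- s) c k ^+ 2) * expR (l * averages s F z).
Proof.
move=> l0; elim: s z => [|k s IHs] z.
  by rewrite big_nil mulr0 expR0 mul1r.
rewrite /= big_cons; apply: le_trans (le_average _ _ IHs) _.
rewrite /average/=.
under eq_bigr do rewrite mulrCA.
rewrite -mulr_sumr.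
apply: (@le_trans _ _ (expR (l ^+ 2 / 8 * \sum_(j <- s) c j ^+ 2) *
  (expR (l ^+ 2 * c k ^+ 2 / 8) * expR (l * average k (averages s F) z)))).
  rewrite ler_wpM2l ?expR_ge0//; apply: hoeffding_mgf => // a b.
  by rewrite -(resample_twice z b a); exact: averages_diff.
by rewrite mulrA -expRD le_eqVlt; apply/orP; left; apply/eqP; congr (expR _ * _); ring.
Qed.

(** Chernoff's method: bound the indicator by an exponential and use
    [averages_mgf] on all coordinates. *)
Lemma mcdiarmid (t : R) : 0 < \sum_k c k ^+ 2 -> 0 <= t ->
  expect (fun z => ((expect F + t <= F z)%R)%:R) <=
  expR (- (2 * t ^+ 2 / \sum_k c k ^+ 2)).
Proof.
set V := \sum_k _ => V0 t0.
have [z0 _|Z0] := pickP (@predT point); last first.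
  by rewrite /expect big_pred0 ?expR_ge0// => z; have := Z0 z.
(* This l minimizes the exponent l ^+ 2 * V / 8 - l * t. *)
pose l := 4 * t / V.
have l0 : 0 <= l by rewrite divr_ge0 ?mulr_ge0// ltW.
have mgf : expect (fun z => expR (l * F z)) <= expR (l ^+ 2 / 8 * V + l * expect F).
  rewrite -(averages_enum _ z0) -(averages_enum F z0).
  by apply: le_trans (averages_mgf _ _ l0) _; rewrite expRD big_enum.
apply: (@le_trans _ _ (expect (fun z => expR (- (l * (expect F + t))) * expR (l * F z)))).
  apply: le_expect => z; rewrite -expRD.
  have [Fz|_] := leP (expect F + t) (F z); last exact: expR_ge0.
  by rewrite /= -expR0 ler_expR addrC subr_ge0 ler_wpM2l.
rewrite expectZ; apply: le_trans (ler_wpM2l (expR_ge0 _) mgf) _.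
rewrite -expRD ler_expR le_eqVlt; apply/orP; left; apply/eqP.
by rewrite /l; field; exact: lt0r_neq0.
Qed.

End BoundedDifferences.
End ProductMeasure.

(** * The incompatibility index and total variation *)

Section IncompatibilityIndex.
Variables (R : realType) (d : nat) (m : 'I_d -> nat) (SS : {set {set 'I_d}}).
Hypothesis SS_neq0 : SS != finset.set0.
Local Notation G := (@Gplus R d m SS).
Implicit Types P Q f : fun_seq R m SS.

Definition tv_total P Q : R := 2^-1 * \sum_S \sum_y `|P S y - Q S y|.

Lemma card_members : #|members SS| = #|SS|.
Proof. by rewrite card_sig; apply: eq_card. Qed.

Lemma card_SS_gt0 : 0 < #|SS|%:R :> R.
Proof. by rewrite ltr0n card_gt0. Qed.

Lemma tv_totalC P Q : tv_total P Q = tv_total Q P.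
Proof.
by congr (_ * _); apply: eq_bigr => S _; apply: eq_bigr => y _; rewrite distrC.
Qed.

(** Lowering f raises its pairing with nonnegative functions, and the level
    |SS| - 1 is high enough for the truncation to stay in [Gplus]. *)
Definition truncate f : fun_seq R m SS :=
  fun S y => Num.min (f S y) (#|SS|%:R - 1).
Arguments truncate : clear implicits.

(** If a component of f exceeds |SS| - 1 at x, then after truncation it balances
    the |SS| - 1 other components, each at least -1; otherwise nothing changes
    at x. *)
Lemma Gplus_truncate f : G f -> G (truncate f).
Proof.
move=> [f_ge f_sum]; have SS1 : 1 <= #|SS|%:R :> R by rewrite ler1n card_gt0.
have tf_ge S y : -1 <= truncate f S y by rewrite /truncate le_min f_ge/=; lra.
split=> // x.
have [[S0 S0x]|/forallNP small] := pselect (exists S, #|SS|%:R - 1 < f S (restr (val S) x)).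
  rewrite (bigD1 S0)//= {1}/truncate min_r; last exact: ltW.
  have -> : #|SS|%:R - 1 = - \sum_(S : members SS | S != S0) (-1) :> R.
    by rewrite sumr_const cardC1 card_members -mulNrn opprK -subn1 natrB ?card_gt0.
  by rewrite addrC subr_ge0; apply: ler_sum.
rewrite (eq_bigr (fun S => f S (restr (val S) x)))//= => S _.
by rewrite /truncate min_l// leNgt; apply/negP/small.
Qed.

Lemma pairing_le1 Q f : distr_seq Q -> G f -> pairing Q f <= 1.
Proof.
move=> Qd [f_ge _]; rewrite /pairing -mulrN ler_pdivrMl ?card_SS_gt0// mulr1.
rewrite lerNl -card_members -sumr_const -sumrN; apply: ler_sum => S _.
rewrite -(Qd S).2 -sumrN; apply: ler_sum => y _.
by rewrite -mulN1r ler_wpM2r ?(Qd S).1.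
Qed.

Lemma pairing_has_sup Q : distr_seq Q -> has_ubound [set pairing Q f | f in G].
Proof. by move=> Qd; exists 1 => _ [f fG <-]; exact: pairing_le1. Qed.

Lemma pairing_values_neq0 Q : [set pairing Q f | f in G] !=set0.
Proof.
exists (pairing Q (fun _ _ => 0)); exists (fun _ _ => 0) => //; split=> [S y|x].
  by lra.
by rewrite sumr_ge0.
Qed.

(** Each truncated component takes values in [-1, |SS| - 1].  As P S and Q S have
    the same mass, it may be centered at the midpoint |SS| / 2 - 1, after which
    it is bounded by |SS| / 2. *)
Lemma pairing_truncate P Q f : distr_seq P -> distr_seq Q -> G f ->
  pairing P (truncate f) <= pairing Q (truncate f) + tv_total P Q.
Proof.
move=> Pd Qd fG; have [tf_ge _] := Gplus_truncate fG; have N0 := card_SS_gt0.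
rewrite -lerBlDl /pairing opprK addrC -mulrBr -sumrB.
rewrite ler_pdivrMl// /tv_total.
rewrite [leRHS]mulrA mulr_sumr; apply: ler_sum => S _.
rewrite -sumrB mulr_sumr.
have cE : \sum_y (#|SS|%:R / 2 - 1) * (Q S y - P S y) = 0.
  by rewrite -mulr_sumr sumrB (Pd S).2 (Qd S).2 subrr mulr0.
have -> : \sum_y (truncate f S y * Q S y - truncate f S y * P S y) =
    \sum_y (truncate f S y - (#|SS|%:R / 2 - 1)) * (Q S y - P S y).
  by rewrite -[LHS]subr0 -[X in _ - X]cE -sumrB; apply: eq_bigr => y _; ring.
apply: ler_sum => y _; apply: le_trans (ler_norm _) _.
rewrite normrM [`|Q S y - _|]distrC ler_wpM2r//.
rewrite ler_norml.
have := tf_ge S y.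
have : truncate f S y <= #|SS|%:R - 1 by rewrite /truncate ge_min lexx orbT.
by move=> h1 h2; apply/andP; split; lra.
Qed.

Lemma incompat_index_lip P Q : distr_seq P -> distr_seq Q ->
  incompat_index P <= incompat_index Q + tv_total P Q.
Proof.
move=> Pd Qd; apply: ge_sup; first exact: pairing_values_neq0.
move=> _ [f fG <-].
apply: (@le_trans _ _ (pairing P (truncate f))).
  rewrite /pairing lerN2 ler_pM2l ?invr_gt0 ?card_SS_gt0//.
  apply: ler_sum => S _; apply: ler_sum => y _.
  by rewrite ler_wpM2r ?(Pd S).1// /truncate ge_min lexx.
apply: le_trans (pairing_truncate Pd Qd fG) _; rewrite lerD2r.
apply: ub_le_sup; first exact: pairing_has_sup.
by exists (truncate f) => //; exact: Gplus_truncate.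
Qed.

(** If Q has the marginals P S, then pairing P with f integrates against Q the
    function x |-> sum_S f_S(x_S), which is nonnegative on [Gplus]. *)
Lemma incompat_index_compatible P : compatible P -> incompat_index P <= 0.
Proof.
move=> [Q [[Q_ge0 _] QP]]; apply: ge_sup; first exact: pairing_values_neq0.
move=> _ [f [_ f_sum] <-]; rewrite /pairing oppr_le0 mulr_ge0 ?invr_ge0//.
rewrite (_ : \sum_S _ = \sum_x Q x * \sum_S f S (restr (val S) x)); last first.
  under [RHS]eq_bigr do rewrite mulr_sumr.
  rewrite exchange_big/=; apply: eq_bigr => S _.
  rewrite [RHS](partition_big (restr (val S)) predT)//=.
  apply: eq_bigr => y _; rewrite -QP mulr_sumr.
  by apply: eq_bigr => x /eqP <-; rewrite mulrC.
by apply: sumr_ge0 => x _; rewrite mulr_ge0.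
Qed.

End IncompatibilityIndex.

(** * Deviation of the empirical distributions *)

Section EmpiricalDistributions.
Variables (R : realType) (d : nat) (m : 'I_d -> nat) (SS : {set {set 'I_d}}).
Variable n : members SS -> nat.
Hypothesis n_gt0 : forall S, (0 < n S)%N.
Variable P : fun_seq R m SS.
Arguments P : clear implicits.
Hypothesis P_distr : distr_seq P.

Local Notation obs := {S : members SS & 'I_(n S)}.
Local Notation obs_law := (fun k : obs => P (tag k)).
Local Notation sample := {dffun forall k : obs, space_on m (val (tag k))}.

Definition sample_empirical (z : sample) : fun_seq R m SS :=
  empirical R (fun S i => z (Tagged (fun S => 'I_(n S)) i)).
Arguments sample_empirical : clear implicits.

Local Notation deviation := (fun z => tv_total (sample_empirical z) P).

Lemma n_neq0 S : (n S)%:R != 0 :> R.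
Proof. by rewrite pnatr_eq0 -lt0n. Qed.

Lemma sum_obs (F : obs -> R) :
  \sum_k F k = \sum_S \sum_(i < n S) F (Tagged (fun S => 'I_(n S)) i).
Proof.
rewrite (sig_big_dep (J := fun S => 'I_(n S)) xpredT (fun=> xpredT)
  (fun S i => F (Tagged (fun S => 'I_(n S)) i)))/=.
by apply: eq_bigr => -[].
Qed.

Lemma obs_law_distr (k : obs) : is_distr (P (tag k)).
Proof. exact: P_distr. Qed.

Lemma sample_empirical_distr z : distr_seq (sample_empirical z).
Proof.
move=> S; split=> [y|]; rewrite /sample_empirical /empirical.
  by rewrite divr_ge0// sumr_ge0.
rewrite -mulr_suml exchange_big/= (eq_bigr (fun=> 1)) => [|i _].
  by rewrite sumr_const card_ord divff ?n_neq0.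
by rewrite -natr_sum (bigD1 (z (Tagged _ i)))//= eqxx big1// => y
  /negPf; rewrite eq_sym => ->.
Qed.

(** The changed observation moves a mass 1/n_S between two points, which costs
    2/n_S in L1 norm and half of it in total variation. *)
Lemma deviation_diff (z : sample) (k : obs) (a : space_on m (val (tag k))) :
  deviation (resample z a) - deviation z <= 1 / (n (tag k))%:R.
Proof.
rewrite /tv_total -mulrBr ler_pdivrMl//.
(* Contributions are counted per observation, so that only k remains. *)
pose jump (l : obs) (y : space_on m (val (tag l))) : R :=
  `|(resample z a l == y)%:R - (z l == y)%:R| / (n (tag l))%:R.
apply: (@le_trans _ _ (\sum_l \sum_y jump l y)).
  rewrite sum_obs.
  rewrite -sumrB; apply: ler_sum => S _.
  apply: (@le_trans _ _ (\sum_(y : space_on m (val S)) \sum_(i < n S)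
      jump (Tagged (fun S => 'I_(n S)) i) y)); last by rewrite exchange_big.
  rewrite -sumrB; apply: ler_sum => y _.
  apply: le_trans (lerB_dist _ _) _.
  rewrite opprB addrA subrK /sample_empirical /empirical -mulrBl -sumrB.
  rewrite normrM [X in _ * X]ger0_norm ?invr_ge0// /jump.
  apply: le_trans (ler_wpM2r _ (ler_norm_sum _ _ _)) _; first by rewrite invr_ge0.
  by rewrite mulr_suml.
rewrite (bigD1 k)//= [X in _ + X]big1 ?addr0; last first.
  move=> l lk; rewrite big1// => y _.
  by rewrite /jump resample_out 1?eq_sym// subrr normr0 mul0r.
rewrite /jump -mulr_suml resample_in div1r ler_wpM2r ?invr_ge0//.
have one (b : space_on m (val (tag k))) : \sum_y (b == y)%:R = 1 :> R.
  rewrite (bigD1 b)//= eqxx big1 ?addr0// => y /negPf.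
  by rewrite eq_sym => ->.
apply: (@le_trans _ _ (\sum_y ((a == y)%:R + (z k == y)%:R))).
  apply: ler_sum => y _; apply: le_trans (ler_normB _ _) _.
  by rewrite !ger0_norm.
by rewrite big_split/= !one.
Qed.

Lemma sum_sqr_diff :
  \sum_(k : obs) (1 / (n (tag k))%:R) ^+ 2 = \sum_S 1 / (n S)%:R :> R.
Proof.
rewrite sum_obs; apply: eq_bigr => S _.
transitivity (\sum_(i < n S) (1 / (n S)%:R) ^+ 2 : R) => //.
rewrite sumr_const card_ord -mulr_natr.
by field; exact: n_neq0.
Qed.

(** The empirical frequency is an average of n_S independent Bernoulli variables:
    in the expanded square the cross terms have mean zero. *)
Lemma empirical_variance (S : members SS) (y : space_on m (val S)) :
  expect obs_law (fun z => (sample_empirical z S y - P S y) ^+ 2) =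
  P S y * (1 - P S y) / (n S)%:R.
Proof.
pose g (a : space_on m (val S)) : R := (a == y)%:R - P S y.
pose k (i : 'I_(n S)) : obs := Tagged (fun S => 'I_(n S)) i.
have mass_y : \sum_a P S a * (a == y)%:R = P S y.
  rewrite (bigD1 y)//= eqxx mulr1 big1 ?addr0// => a /negPf ->.
  by rewrite mulr0.
have g_mean : \sum_a P S a * g a = 0.
  rewrite (eq_bigr (fun a => P S a * (a == y)%:R - P S a * P S y)); last first.
    by move=> a _; rewrite /g; ring.
  by rewrite sumrB mass_y -mulr_suml (P_distr S).2 mul1r subrr.
have g_var : \sum_a P S a * (g a * g a) = P S y * (1 - P S y).
  rewrite (eq_bigr (fun a => (1 - 2 * P S y) * (P S a * (a == y)%:R)
      + P S a * P S y ^+ 2)); last first.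
    by move=> a _; rewrite /g; case: (a == y); rewrite /=; ring.
  by rewrite big_split/= -mulr_sumr mass_y -mulr_suml (P_distr S).2; ring.
have devE z : (sample_empirical z S y - P S y) ^+ 2 =
    (n S)%:R ^- 2 * \sum_i \sum_j g (z (k i)) * g (z (k j)).
  under [in RHS]eq_bigr do rewrite -mulr_sumr.
  rewrite -mulr_suml -expr2 -exprVn -exprMn; congr (_ ^+ 2).
  rewrite /g sumrB sumr_const card_ord -mulr_natr.
  by rewrite /sample_empirical /empirical; field; exact: n_neq0.
rewrite (_ : (fun z : sample => _) = fun z : sample => (n S)%:R ^- 2 *
    \sum_i \sum_j g (z (k i)) * g (z (k j))); last exact/funext.
rewrite expectZ expect_sum.
under eq_bigr do rewrite expect_sum.
rewrite (eq_bigr (fun=> P S y * (1 - P S y))) => [|i _].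
  by rewrite sumr_const card_ord -mulr_natr; field; exact: n_neq0.
rewrite (bigD1 i)//= big1 ?addr0 => [|j ji].
  by rewrite (@expect_coord _ _ _ _ obs_law_distr (k i) (fun a => g a * g a)).
apply: (@expect_coord2 _ _ _ _ obs_law_distr (k i) (k j)) => //.
by rewrite eq_Tagged/= eq_sym.
Qed.

(** Cauchy-Schwarz is used three times: over samples, to pass from the first to
    the second moment; over the N points y, to pass to the sum of the variances;
    and to get sum_y P(y)^2 >= 1/N. *)
Lemma expect_l1_empirical (S : members SS) :
  \sum_y expect obs_law (fun z => `|sample_empirical z S y - P S y|) <=
  Num.sqrt ((#|space_on m (val S)|%:R - 1) / (n S)%:R).
Proof.
pose e (y : space_on m (val S)) := expect obs_law
  (fun z => `|sample_empirical z S y - P S y|).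
rewrite -[leLHS]/(\sum_y e y); set N := #|_|%:R.
have N_sum (h : space_on m (val S) -> R) : (\sum_y h y) ^+ 2 <= N * \sum_y h y ^+ 2.
  have := weighted_cauchy h (fun _ => ler01 : 0 <= 1).
  rewrite sumr_const; under eq_bigr do rewrite mul1r.
  by under [in leRHS]eq_bigr do rewrite mul1r.
have e_ge0 : 0 <= \sum_y e y.
  apply: sumr_ge0 => y _; rewrite -(expect_cst obs_law_distr 0).
  exact: le_expect.
have e_sqr y : e y ^+ 2 <= P S y * (1 - P S y) / (n S)%:R.
  rewrite -empirical_variance.
  have := weighted_cauchy (fun z => `|sample_empirical z S y - P S y|)
    (product_mass_ge0 obs_law_distr).
  rewrite (product_mass_sum1 obs_law_distr) mul1r.
  under [in leRHS]eq_bigr do rewrite /= real_normK ?num_real//.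
  exact.
rewrite -(ger0_norm e_ge0) -sqrtr_sqr ler_wsqrtr//.
apply: le_trans (N_sum e) _.
have N_ge0 : 0 <= N by [].
apply: (@le_trans _ _ (N * \sum_y P S y * (1 - P S y) / (n S)%:R)).
  by rewrite ler_wpM2l//; apply: ler_sum.
rewrite -mulr_suml mulrA ler_wpM2r ?invr_ge0//.
rewrite (eq_bigr (fun y => P S y - P S y ^+ 2)); last by move=> y _; ring.
have := N_sum (P S); rewrite sumrB (P_distr S).2 expr1n => h.
by rewrite mulrBr mulr1 lerB.
Qed.

Lemma expect_deviation :
  expect obs_law deviation <=
  2^-1 * \sum_S Num.sqrt ((#|space_on m (val S)|%:R - 1) / (n S)%:R).
Proof.
rewrite expectZ ler_wpM2l// expect_sum; apply: ler_sum => S _.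
by rewrite expect_sum; exact: expect_l1_empirical.
Qed.

Hypothesis SS_neq0 : SS != finset.set0.

(** The critical value exceeds the mean of the deviation by at least the t at
    which McDiarmid's bound is equal to a. *)
Lemma deviation_tail (a : R) : 0 < a -> a < 1 ->
  expect obs_law (fun z => ((critical_value m n a <= deviation z)%R)%:R) <= a.
Proof.
move=> a0 a1.
have V0 : 0 < \sum_S 1 / (n S)%:R :> R.
  have [S SSS] : exists S, S \in SS by apply/set0Pn.
  rewrite (bigD1 (exist _ S SSS))//= ltr_wpDr//.
    by apply: sumr_ge0 => ? _; rewrite divr_ge0.
  by rewrite divr_gt0// ltr0n.
set V := \sum_S _ in V0.
have L0 : 0 < ln (1 / a) by rewrite ln_gt0// ltr_pdivlMr// mul1r.
set t := Num.sqrt (2^-1 * ln (1 / a) * V).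
have mcd := mcdiarmid obs_law_distr deviation_diff.
rewrite sum_sqr_diff -/V in mcd.
apply: le_trans (le_trans (mcd t V0 (sqrtr_ge0 _)) _).
  apply: le_expect => z; first exact: obs_law_distr.
  have [crit|_] := leP (critical_value m n a) (deviation z); last by [].
  suff -> : expect obs_law deviation + t <= deviation z by [].
  apply: le_trans crit; rewrite /critical_value lerD2r.
  exact: expect_deviation.
rewrite sqr_sqrtr; last by rewrite !mulr_ge0// ltW.
rewrite (_ : 2 * _ / V = ln (1 / a)); last by field; exact: lt0r_neq0.
by rewrite div1r lnV ?posrE// opprK lnK ?posrE.
Qed.

End EmpiricalDistributions.

(** * The joint law of the observations *)

Section JointLaw.
Variables (R : realType) (dO : measure_display) (Omega : measurableType dO).
Variables (Pr : probability Omega R) (K : finType) (T : K -> finType).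
Variables (X : forall k, Omega -> T k) (p : forall k, T k -> R).
Hypothesis X_meas : forall k, random_element (X k).
Hypothesis X_law : forall k, has_law Pr (X k) (@p k).
Hypothesis X_indep : mutually_independent Pr X.

Definition joint (w : Omega) : {dffun forall k, T k} := [ffun k => X k w].

Lemma joint_preimage z :
  joint @^-1` [set z] = \bigcap_(k in [set k | k \in [set: K]%SET]) (X k @^-1` [set z k]).
Proof.
apply/seteqP; split=> w; first by move=> /= <- k _ /=; rewrite ffunE.
by move=> /= Xz; apply/ffunP => k; rewrite ffunE Xz/= ?inE.
Qed.

Lemma joint_measurable z : measurable (joint @^-1` [set z]).
Proof.
rewrite joint_preimage; apply: fin_bigcap_measurable => // k _; exact: X_meas.
Qed.

Lemma joint_law z : Pr (joint @^-1` [set z]) = (product_mass p z)%:E.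
Proof.
rewrite joint_preimage (X_indep [set: K]%SET (fun k => [set z k])).
rewrite (eq_bigr (fun k => (p (z k))%:E)) => [|k _]; last exact: X_law.
by rewrite prodEFin; congr EFin; apply: eq_bigl => k; rewrite !inE.
Qed.

(** An event that depends on finitely many discrete observations is a finite
    disjoint union of atoms of their joint law. *)
Lemma probability_joint (A : pred {dffun forall k, T k}) :
  Pr [set w | A (joint w)] = (expect p (fun z => (A z)%:R))%:E.
Proof.
pose r := [seq z <- index_enum {dffun forall k, T k} | A z].
have -> : [set w | A (joint w)] = \bigcup_(z in [set` r]) (joint @^-1` [set z]).
  apply/seteqP; split=> w /=.
    by move=> Aw; exists (joint w) => //=; rewrite mem_filter Aw mem_index_enum.
  by move=> [z /=]; rewrite mem_filter => /andP[Az _] ->.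
rewrite measure_fin_bigcup//.
- rewrite -fsbig_seq ?filter_uniq ?index_enum_uniq// big_filter.
  rewrite (eq_bigr (fun z => (product_mass p z)%:E)) => [|z _]; last exact: joint_law.
  rewrite sumEFin big_mkcond/=; congr EFin; apply: eq_bigr => z _.
  by case: (A z); rewrite ?mulr1 ?mulr0.
- by move=> z z' _ _ [w [/= -> ->]].
- by move=> z _; exact: joint_measurable.
Qed.

End JointLaw.

(** * Size and power of the test *)

Unset Implicit Arguments.

Theorem proposition3
  (R : realType)
  (d : nat) (d_gt0 : (0 < d)%N)
  (m : 'I_d -> nat) (m_gt0 : forall j, (0 < m j)%N)
  (SS : {set {set 'I_d}}) (SS_neq0 : SS != finset.set0)
  (n : members SS -> nat) (n_gt0 : forall S, (0 < n S)%N)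
  (alpha beta : R)
  (alpha_gt0 : 0 < alpha) (alpha_lt1 : alpha < 1)
  (beta_gt0 : 0 < beta) (beta_lt1 : beta < 1)
  (P : fun_seq R m SS) (P_distr : distr_seq P)
  (dO : measure_display) (Omega : measurableType dO) (Pr : probability Omega R)
  (X : forall S : members SS, 'I_(n S) -> Omega -> space_on m (val S))
  (X_meas : forall S i, random_element (X S i))
  (X_law : forall S i, has_law Pr (X S i) (P S))
  (X_indep : mutually_independent Pr
     (fun k : {S : members SS & 'I_(n S)} => X (tag k) (tagged k))) :
  let R_hat (w : Omega) : R :=
    incompat_index (empirical R (fun S i => X S i w)) in
  (compatible P ->
     (Pr [set w | (critical_value m n alpha <= R_hat w)%R] <= alpha%:E)%E) /\
  (critical_value m n alpha + critical_value m n beta <= incompat_index P ->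
     ((1 - beta)%:E <= Pr [set w | (critical_value m n alpha <= R_hat w)%R])%E).
Proof.
move=> R_hat.
(* All observations, from all the samples, form one point of a finite product. *)
pose law (k : {S : members SS & 'I_(n S)}) := P (tag k).
have law_distr k : is_distr (law k) by exact: P_distr.
pose stat (z : {dffun forall k : {S : members SS & 'I_(n S)}, space_on m (val (tag k))}) :=
  incompat_index (sample_empirical R z).
have statE w : stat (joint (fun k => X (tag k) (tagged k)) w) = R_hat w.
  congr (incompat_index (empirical R _)).
  by apply/functional_extensionality_dep => S; apply/funext => i; rewrite ffunE.
have test_prob : Pr [set w | (critical_value m n alpha <= R_hat w)%R] =
    (expect law (fun z => ((critical_value m n alpha <= stat z)%R)%:R))%:E.
  rewrite -(probability_joint (fun k => X_meas (tag k) (tagged k))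
    (fun k => X_law (tag k) (tagged k)) X_indep
    (fun z => critical_value m n alpha <= stat z)).
  apply: (congr1 (fun A : set Omega => Pr A)); apply/funext => w; rewrite /mkset.
  by rewrite statE.
have lip z : stat z <= incompat_index P + tv_total (sample_empirical R z) P /\
    incompat_index P <= stat z + tv_total (sample_empirical R z) P.
  have z_distr := sample_empirical_distr R n_gt0 z.
  split; first exact: incompat_index_lip.
  by rewrite tv_totalC; exact: incompat_index_lip.
rewrite test_prob !lee_fin; split=> [P_compat|P_far].
  apply: le_trans (deviation_tail n_gt0 P_distr SS_neq0 alpha_gt0 alpha_lt1).
  apply: le_expect => // z; rewrite /=; case: (leP _ (stat z)) => // crit.
  suff -> : critical_value m n alpha <= tv_total (sample_empirical R z) P by [].
  apply: le_trans crit (le_trans (lip z).1 _).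
  by rewrite gerDr incompat_index_compatible.
have := deviation_tail n_gt0 P_distr SS_neq0 beta_gt0 beta_lt1.
rewrite lerBlDr => beta_tail; rewrite -[leLHS](expect_cst law_distr).
apply: le_trans (lerD (lexx _) beta_tail); rewrite -expectD.
apply: le_expect => // z /=.
case: (leP _ (tv_total (sample_empirical R z) P)) => [_|dev]; first by rewrite lerDr.
suff -> : critical_value m n alpha <= stat z by rewrite addr0.
rewrite -(lerD2r (critical_value m n beta)).
apply: le_trans P_far (le_trans (lip z).2 _).
by rewrite lerD2l ltW.
Qed.
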